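(* Let $n\in\mathbb{N}$ be even, $n\geq 2$, and let $c_1,\dots,c_n\in\mathbb{R}$. If $$\sum_{\substack{1\le k\le n-1\\ k\text{ odd}}}c_k=\sum_{\substack{2\le k\le n\\ k\text{ even}}}c_k,$$ then the function $u:\mathbb{R}^n\to\mathbb{R}$ given by $u(x_1,\dots,x_n)=\sum_{k=1}^{n}c_kx_k$ is a solution to the partial differential equation $$\sum_{k=1}^{n}(-1)^k\frac{\partial u}{\partial x_k}=0.$$ *)

(* Defs.v *)
From HB Require Import structures.
From mathcomp Require Import all_boot all_order all_algebra.
From mathcomp Require Import all_classical all_reals all_analysis.
Set Implicit Arguments.
Unset Strict Implicit.
Unset Printing Implicit Defensive.
Import Order.TTheory GRing.Theory Num.Theory.
Import numFieldNormedType.Exports.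
Local Open Scope ring_scope.

(* Indices are shifted: the ordinal [k : 'I_n] (with value 0, ..., n - 1)
   stands for the 1-based index [k.+1]. *)

Definition partial_derivable (R : realType) (n : nat) (u : 'rV[R]_n -> R)
    (k : 'I_n) (x : 'rV[R]_n) : Prop :=
  derivable u x (delta_mx 0 k).

Definition partial_derivative (R : realType) (n : nat) (u : 'rV[R]_n -> R)
    (k : 'I_n) (x : 'rV[R]_n) : R :=
  'D_(delta_mx 0 k) u x.

(* ['D_v u x] has a junk value where the limit does not exist, so the
   existence of the partial derivatives is required separately. *)
Definition C1 (R : realType) (n : nat) (u : 'rV[R]_n -> R) : Prop :=
  forall k : 'I_n,
    (forall x, partial_derivable u k x) /\ continuous (partial_derivative u k).

(* Classical solution on the whole space of
   sum_{k=1}^n (-1)^k du/dx_k = 0. *)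
Definition alternating_pde_solution (R : realType) (n : nat)
    (u : 'rV[R]_n -> R) : Prop :=
  C1 u /\
  forall x, \sum_(k < n) (-1) ^+ k.+1 * partial_derivative u k x = 0.

(* Main.v *)
Require Import Defs.
From HB Require Import structures.
From mathcomp Require Import all_boot all_order all_algebra.
From mathcomp Require Import all_classical all_reals all_analysis.
Set Implicit Arguments.
Unset Strict Implicit.
Unset Printing Implicit Defensive.
Import Order.TTheory GRing.Theory Num.Theory.
Import numFieldNormedType.Exports.
Local Open Scope ring_scope.

(** A linear form is its own derivative, so the k-th partial derivative of
    [u x = \sum_k c k * x 0 k] is the constant [u e_k = c k]
    ([is_derive_linear], [coord_form_delta]). In particular [u] is C1, and the
    equation reduces to the vanishing of the alternating sum of the
    coefficients, which is the balance hypothesis once the sum is split by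
    the parity of the index ([alternating_sum]). *)

(** The difference quotient of a linear map is constant off the origin, so
    its limit exists even when the map is unbounded. *)
Lemma is_derive_linear (R : numFieldType) (V W : normedModType R) (u : V -> W)
  (x v : V) : linear u -> is_derive x v u (u v).
Proof.
move=> u_lin.
have quotient_cvg :
    ((fun h : R => h^-1 *: (u (h *: v + x) - u x)) @ 0^' --> u v)%classic.
  apply: cvg_near_cst; near=> h.
  have h_neq0 : h != 0 by near: h; exact: nbhs_dnbhs_neq.
  by rewrite u_lin addrK scalerA mulVf // scale1r.
apply: DeriveDef; last exact: cvg_lim quotient_cvg.
by apply/cvg_ex; exists (u v).
Unshelve. all: by end_near. Qed.

Lemma coord_form_linear (R : comPzRingType) (n : nat) (c : 'I_n -> R) :
  linear (fun x : 'rV[R]_n => \sum_(k < n) c k * x 0 k : R^o).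
Proof.
move=> a x y; rewrite scaler_sumr -big_split; apply: eq_bigr => k _ /=.
by rewrite !mxE mulrDr mulrCA.
Qed.

Lemma coord_form_delta (R : pzRingType) (n : nat) (c : 'I_n -> R) (k : 'I_n) :
  \sum_(j < n) c j * (delta_mx 0 k : 'rV[R]_n) 0 j = c k.
Proof.
rewrite (bigD1 k) //= big1 => [|j /negPf jk].
  by rewrite addr0 mxE !eqxx mulr1.
by rewrite mxE jk mulr0.
Qed.

Lemma alternating_sum (R : pzRingType) (n : nat) (c : 'I_n -> R) :
  \sum_(k < n) (-1) ^+ k.+1 * c k =
  \sum_(k < n | ~~ odd k.+1) c k - \sum_(k < n | odd k.+1) c k.
Proof.
rewrite (bigID (fun k : 'I_n => odd k.+1)) [RHS]addrC -sumrN; congr (_ + _).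
  by apply: eq_bigr => k /= k_odd; rewrite -signr_odd /= k_odd mulN1r.
by apply: eq_bigr => k /= /negPf k_even; rewrite -signr_odd /= k_even mul1r.
Qed.

Theorem proposition3 (R : realType) (n : nat) (c : 'I_n -> R)
  (n_even : ~~ odd n) (n_ge2 : (2 <= n)%N)
  (hc : \sum_(k < n | odd k.+1) c k = \sum_(k < n | ~~ odd k.+1) c k) :
  alternating_pde_solution (fun x : 'rV[R]_n => \sum_(k < n) c k * x 0 k).
Proof.
set u := fun x : 'rV[R]_n => _.
have u_deriv k x : is_derive x (delta_mx 0 k) u (c k).
  rewrite -(coord_form_delta c k).
  exact: (is_derive_linear _ _ (coord_form_linear c)).
have u_partial k : partial_derivative u k = cst (c k).
  by apply/funext => x; exact: derive_val.
split=> [k|x].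
  split=> [x|]; first exact: ex_derive.
  by rewrite u_partial; exact: cst_continuous.
under eq_bigr do rewrite u_partial.
by rewrite alternating_sum hc subrr.
Qed.
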